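(* Let $r_1,r_2\in\mathbb{Z}^+$, let $G_1$ be a finite $3r_1$-regular graph and $G_2$ a finite $2r_2$-regular graph. Suppose $G_1$ is 3-balanced and $G_2$ is 2-balanced. Then the tensor product $G_1\times G_2$ is 3-balanced.
   Context: A graph is 3-balanced if it admits a vertex coloring $\ell:V\to\mathbb{Z}_3$ such that every vertex has, in its open neighborhood, the same number of vertices of each of the three colors. A graph is 2-balanced if it admits a vertex coloring with two colors such that every vertex has, in its open neighborhood, the same number of vertices of each of the two colors. The tensor product $G_1\times G_2$ has vertex set $V(G_1)\times V(G_2)$ with $(u,v)\sim(u',v')$ iff $uu'\in E(G_1)$ and $vv'\in E(G_2)$. *)

(* Defs.v *)
From HB Require Import structures.
From mathcomp Require Import all_boot all_order all_algebra.

Set Implicit Arguments.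
Unset Strict Implicit.
Unset Printing Implicit Defensive.

Record sgraph := SGraph {
  vertex :> finType;
  adj : rel vertex;
  adj_sym : symmetric adj;
  adj_irr : irreflexive adj
}.

Definition neighborhood (G : sgraph) (v : G) : {set G} := [set w | adj v w].

Definition regular (k : nat) (G : sgraph) : Prop :=
  forall v : G, #|neighborhood v| = k.

(* Vertex colorings here are arbitrary maps: adjacent vertices may share a
   color. *)
Definition balanced_coloring (G : sgraph) (C : finType) (l : G -> C) : Prop :=
  forall (v : G) (c c' : C),
    #|[set w in neighborhood v | l w == c]| =
    #|[set w in neighborhood v | l w == c']|.

Definition three_balanced (G : sgraph) : Prop :=
  exists l : G -> 'Z_3, balanced_coloring l.

Definition two_balanced (G : sgraph) : Prop :=
  exists l : G -> bool, balanced_coloring l.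

Section TensorProduct.
Variables G1 G2 : sgraph.

Definition tensor_adj : rel (G1 * G2)%type :=
  fun x y => adj x.1 y.1 && adj x.2 y.2.

Fact tensor_adj_sym : symmetric tensor_adj.
Proof. by move=> x y; rewrite /tensor_adj adj_sym [adj x.2 _]adj_sym. Qed.

Fact tensor_adj_irr : irreflexive tensor_adj.
Proof. by move=> x; rewrite /tensor_adj adj_irr. Qed.

Definition tensor_product : sgraph := SGraph tensor_adj_sym tensor_adj_irr.

End TensorProduct.

(* Main.v *)
(** Colouring [(u, v)] by the colour of [u] in [G1] suffices: the neighbours of
    [(u, v)] of a given colour form the product of the equally coloured
    neighbours of [u] with the whole neighbourhood of [v]. *)
Require Import Defs.
From HB Require Import structures.
From mathcomp Require Import all_boot all_order all_algebra.

(** Both memberships unfold to the same three conditions on [y], namely two adjacencies and a colour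
    test that sees only [y.1]; [andbAC] moves the test next to the adjacency in [G1]. *)
Lemma tensor_color_class (G1 G2 : sgraph) (C : finType) (l : G1 -> C)
    (x : tensor_product G1 G2) (c : C) :
  [set y in neighborhood x | l y.1 == c] =
  setX [set w in neighborhood x.1 | l w == c] (neighborhood x.2).
Proof. by apply/setP=> y; rewrite !inE /= /tensor_adj andbAC. Qed.

(** By the product form, each class size is that of the class of [l] around [x.1] times
    [#|neighborhood x.2|]. The first factor is the same for all colours by balance, and the second
    does not involve the colour. *)
Lemma balanced_coloring_tensor (G1 G2 : sgraph) (C : finType) (l : G1 -> C) :
  balanced_coloring l ->
  balanced_coloring (fun x : tensor_product G1 G2 => l x.1).
Proof.
move=> bal x c c'.
by rewrite !tensor_color_class !cardsX (bal x.1 c c').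
Qed.

Theorem theorem6p8 (r1 r2 : nat) (hr1 : 0 < r1) (hr2 : 0 < r2)
    (G1 G2 : sgraph)
    (reg1 : regular (3 * r1) G1) (reg2 : regular (2 * r2) G2)
    (bal1 : three_balanced G1) (bal2 : two_balanced G2) :
  three_balanced (tensor_product G1 G2).
Proof.
case: bal1 => l bal; exists (fun x => l x.1).
exact: balanced_coloring_tensor.
Qed.
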